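(* Let $h_{ij}$ be the probability density function of $$x_{ij}(t+1)=\tfrac13\sum_{k=1}^3 p_{kj}+\tfrac13\sum_{k=1}^3 A_{kj}\,|C_{kj}p_{kj}-x_{ij}|,$$ where $p_{1j},p_{2j},p_{3j},x_{ij}$ are fixed reals and $A_{kj}\sim U[-a,a]$, $C_{kj}\sim U[0,2]$ ($k=1,2,3$) are all independent. Let $n_{kj}=a(|p_{kj}|+|x_{ij}-p_{kj}|)$, assumed positive for $k=1,2,3$, and $\sum p_j=p_{1j}+p_{2j}+p_{3j}$, $\sum n_j=n_{1j}+n_{2j}+n_{3j}$. Then the graph of $h_{ij}$ is symmetric about $u_j=\frac13\sum p_j$; $h_{ij}\bigl(\frac13\sum p_j-\frac13\sum n_j\bigr)=0$; and $h_{ij}$ is non-decreasing on $\bigl(\frac13\sum p_j-\frac13\sum n_j,\ \frac13\sum p_j\bigr)$.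
   Context: Setting: coordinate $j$ of one update step of the grey wolf optimizer, with $a=a(t)=2(1-t/T)>0$ at iteration $1\le t<T$; the coordinates of the three best search agents and of the current position of agent $i$ are constants. $U[p,q]$ is the uniform distribution on $[p,q]$. Densities are defined up to null sets; the statement concerns the version of $h_{ij}$ given by the (everywhere defined) scaled convolution $u\mapsto 3(g_{1j}*g_{2j}*g_{3j})(3u)$, where $g_{kj}$ is the density of $p_{kj}+A_{kj}|C_{kj}p_{kj}-x_{ij}|$. *)

(* Defs.v *)
From HB Require Import structures.
From mathcomp Require Import all_boot all_order all_algebra.
From mathcomp Require Import all_classical all_reals all_analysis.
From mathcomp Require Import measurable_realfun.
Set Implicit Arguments.
Unset Strict Implicit.
Unset Printing Implicit Defensive.
Import Order.TTheory GRing.Theory Num.Theory.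
Import numFieldNormedType.Exports.
Local Open Scope classical_set_scope.
Local Open Scope ring_scope.

Section defs.
Context {d : measure_display} {Om : measurableType d} {R : realType}.
Variable P : probability Om R.

Definition mutually_independent {I : finType} (X : I -> {RV P >-> R}) : Prop :=
  forall (S : {set I}) (B : I -> set (measurableTypeR R)),
    (forall i, measurable (B i)) ->
    P (\bigcap_(i in [set i | i \in S]) (X i @^-1` B i)) =
    (\prod_(i in S) P (X i @^-1` B i))%E.

Definition uniform_on (X : {RV P >-> R}) (p q : R) : Prop :=
  exists pq : p < q, forall B : set (measurableTypeR R), measurable B ->
    distribution P X B = uniform_prob pq B.

(* The value +oo is allowed: the densities convolved below may have
   logarithmic poles. *)
Definition is_pdf (X : Om -> R) (f : R -> \bar R) : Prop :=
  [/\ forall y, (0 <= f y)%E,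
      measurable_fun [set: R] f
    & forall B : set (measurableTypeR R), measurable B ->
        P (X @^-1` B) = (\int[lebesgue_measure]_(y in B) f y)%E].

End defs.

(* For nonnegative measurable f and g this is defined at every u, and it does
   not change when f or g is modified on a null set. *)
Definition convolution {R : realType} (f g : R -> \bar R) (u : R) : \bar R :=
  (\int[lebesgue_measure]_y (f y * g (u - y)%R))%E.

(* Main.v *)
Require Import Defs.
From HB Require Import structures.
From mathcomp Require Import all_boot all_order all_algebra.
From mathcomp Require Import all_classical all_reals all_analysis.
From mathcomp Require Import measurable_realfun.
From mathcomp Require Import ring lra.
Import Order.TTheory GRing.Theory Num.Theory.
Import numFieldNormedType.Exports.
Local Open Scope classical_set_scope.
Local Open Scope ring_scope.

(** Put [Y_k = p_k + A_k |C_k p_k - x|].  Given [C_k = c], the variable [Y_k] is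
    uniform on the interval centred at [p_k] with half-length [a |c p_k - x|],
    and this half-length is at most [n_k] for [c] in [[0, 2]].  Averaging over
    [c], [Y_k] has as a density a mixture of uniform densities that are all
    centred at [p_k] ([encircling_density]).  Such a mixture is symmetric about
    [p_k], nonincreasing in the distance to [p_k] (the predicate [peaked]) and
    zero at distance more than [n_k].  It may be infinite at [p_k].

    These properties pass to convolutions at every point, not just almost
    everywhere: the convolution of two peaked functions is peaked
    ([peaked_convolution], a rearrangement argument), and it vanishes as soon as
    the distance to the sum of the centres reaches the sum of the two radii
    ([convolution_vanishes]).  The given densities [g_k] agree with the mixtures
    only almost everywhere, but a convolution does not see the difference
    ([eq_convolution]), so [h] is everywhere equal to the rescaled convolution
    of the three mixtures.  Its symmetry, its zero at the end of the support and
    its monotonicity are then read off.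

    That [h] is a density of the updated position rests on the independence of
    the [Y_k].  It follows from that of the six variables [A_k], [C_k] by
    replacing product events with arbitrary events in the plane, one index at a
    time ([pairs_independent]).  For two independent variables Fubini's theorem
    gives the density of the sum; it is the same computation, with a different
    change of variables, that gives the density of [Y_k], so both are instances
    of [mixture_pdf]. *)

(** * Affine substitutions in Lebesgue integrals *)

Section real_line.
Context {R : realType}.
Implicit Types (f g : R -> \bar R) (k b c u v x y : R).
Local Notation mu := (@lebesgue_measure R).

Lemma measurable_affine k b :
  measurable_fun [set: R] (fun y : R => k * y + b : R).
Proof. by apply: measurable_funD => //; exact: measurable_funM. Qed.

Lemma preimage_affine_pos k b x y : 0 < k ->
  (fun z => k * z + b) @^-1` `]x, y] = `](x - b) / k, (y - b) / k]%classic.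
Proof.
move=> k0; apply/seteqP; split => z /=;
  rewrite !in_itv/= ltr_pdivrMr// ler_pdivlMr// => /andP[h1 h2];
  apply/andP; split; lra.
Qed.

Lemma preimage_affine_neg k b x y : k < 0 ->
  (fun z => k * z + b) @^-1` `]x, y] = `[(y - b) / k, (x - b) / k[%classic.
Proof.
move=> k0; apply/seteqP; split => z /=;
  rewrite !in_itv/= ltr_ndivlMr// ler_ndivrMr// => /andP[h1 h2];
  apply/andP; split; lra.
Qed.

(** Lebesgue measure is determined by the half-open intervals, so only the two
    preimages computed above matter. *)
Lemma lebesgue_measure_affine k b (A : set R) : k != 0 -> measurable A ->
  mu A = (`|k|%:E * mu ((fun y => (k * y + b)%R) @^-1` A))%E.
Proof.
move=> k0 mA.
pose phi y : measurableTypeR R := k * y + b.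
have mphi : measurable_fun setT phi by exact: measurable_affine.
pose phi_mixin := isMeasurableFun.Build _ _ _ _ _ mphi.
pose Phi : {mfun _ >-> _} := HB.pack phi phi_mixin.
pose kk := NngNum (normr_ge0 k).
rewrite (_ : (_ * _)%E = mscale kk (pushforward mu Phi) A) //.
apply: lebesgue_measure_unique => // _ [[x y]] _ <-.
rewrite lebesgue_measure_itv/= lte_fin.
rewrite [RHS](_ : _ = `|k|%:E * mu ((fun z => k * z + b)%R @^-1` `]x, y]))%E //.
have [k_gt0|k_lt0] := ltP 0 k.
  rewrite (preimage_affine_pos k b x y k_gt0).
  rewrite lebesgue_measure_itv/= lte_fin ltr_pM2r ?invr_gt0// ltrD2r.
  case: ifPn => _; last by rewrite mule0.
  by rewrite -!EFinD -EFinM gtr0_norm//; congr (_%:E); field.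
have {}k_lt0 : k < 0 by rewrite lt_neqAle k0.
rewrite (preimage_affine_neg k b x y k_lt0).
rewrite lebesgue_measure_itv/= lte_fin ltr_nM2r ?invr_lt0// ltrD2r.
case: ifPn => _; last by rewrite mule0.
by rewrite -!EFinD -EFinM ltr0_norm//; congr (_%:E); field.
Qed.

(** Negative slopes are included: [k = -1] gives the reflections on which the
    symmetry arguments rest, positive [k] the rescaling of densities. *)
Lemma ge0_integral_affine k b f : k != 0 -> measurable_fun setT f ->
  (forall y, 0 <= f y)%E ->
  (\int[mu]_y f y = `|k|%:E * \int[mu]_y f (k * y + b)%R)%E.
Proof.
move=> k0 mf f0.
pose phi y : measurableTypeR R := k * y + b.
have mphi : measurable_fun setT phi by exact: measurable_affine.
pose phi_mixin := isMeasurableFun.Build _ _ _ _ _ mphi.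
pose Phi : {mfun _ >-> _} := HB.pack phi phi_mixin.
pose kk := NngNum (normr_ge0 k).
rewrite (eq_measure_integral (mscale kk (pushforward mu Phi))); last first.
  by move=> A mA _; exact: (lebesgue_measure_affine k b A k0 mA).
by rewrite ge0_integral_mscale// ge0_integral_pushforward.
Qed.

(** * Peaked functions and their convolutions *)

(** Symmetry about [c] and monotonicity away from [c] in a single condition:
    symmetry is the case [|s| = |t|]. *)
Definition peaked c f := forall s t, `|s| <= `|t| -> (f (c + t)%R <= f (c + s)%R)%E.

Definition vanishes_beyond c n f := forall s, n < `|s| -> f (c + s) = 0%E.

Lemma convolution_ge0 f g u : (forall y, 0 <= f y)%E -> (forall y, 0 <= g y)%E ->
  (0 <= convolution f g u)%E.
Proof. by move=> f0 g0; apply: integral_ge0 => y _; exact: mule_ge0. Qed.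

Lemma measurable_fun_subl g u : measurable_fun [set: R] g ->
  measurable_fun [set: R] (fun y => g (u - y)).
Proof.
move=> mg; have mB : measurable_fun [set: R] (fun y : R => u - y).
  by apply: measurable_funB.
exact: measurableT_comp mg mB.
Qed.

Lemma measurable_convolution f g :
  measurable_fun setT f -> measurable_fun setT g ->
  (forall y, 0 <= f y)%E -> (forall y, 0 <= g y)%E ->
  measurable_fun setT (convolution f g).
Proof.
move=> mf mg f0 g0.
pose F (z : measurableTypeR R * measurableTypeR R) := (f z.2 * g (z.1 - z.2)%R)%E.
apply: (@measurable_fun_fubini_tonelli_F _ _ _ _ _ mu F) => /=.
  have mB : measurable_fun [set: measurableTypeR R * measurableTypeR R]
      (fun z => z.1 - z.2 : R).
    by apply: measurable_funB; [exact: measurable_fst|exact: measurable_snd].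
  apply: emeasurable_funM; first exact: measurableT_comp.
  exact: measurableT_comp mg mB.
by move=> z; exact: mule_ge0.
Qed.

(** The reflection [y -> b - y] in the integral.  For [b = u] it exchanges the two
    factors; the other centres serve in [peaked_convolution]. *)
Lemma convolutionE_reflect b f g u :
  measurable_fun setT f -> measurable_fun setT g ->
  (forall y, 0 <= f y)%E -> (forall y, 0 <= g y)%E ->
  convolution f g u = (\int[mu]_y (f (b - y)%R * g (u - (b - y))%R))%E.
Proof.
move=> mf mg f0 g0; rewrite /convolution (ge0_integral_affine (-1) b) ?oppr_eq0 ?oner_eq0//.
- by rewrite normrN1 mul1e; apply: eq_integral => y _; rewrite mulN1r addrC.
- by apply: emeasurable_funM => //; exact: measurable_fun_subl.
- by move=> y; exact: mule_ge0.
Qed.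

Lemma convolutionC f g u : measurable_fun setT f -> measurable_fun setT g ->
  (forall y, 0 <= f y)%E -> (forall y, 0 <= g y)%E ->
  convolution f g u = convolution g f u.
Proof.
move=> mf mg f0 g0; rewrite (convolutionE_reflect u)//.
by apply: eq_integral => y _; rewrite muleC subKr.
Qed.

(** A change of [f] on a null set changes the integrand at most on that same set.
    For [g] the exceptional set would move with [u]; commutativity reduces that
    case to the first one. *)
Lemma eq_convolution f f' g g' :
  measurable_fun setT f -> measurable_fun setT f' ->
  measurable_fun setT g -> measurable_fun setT g' ->
  (forall y, 0 <= f y)%E -> (forall y, 0 <= f' y)%E ->
  (forall y, 0 <= g y)%E -> (forall y, 0 <= g' y)%E ->
  ae_eq mu setT f f' -> ae_eq mu setT g g' ->
  convolution f g =1 convolution f' g'.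
Proof.
suff H f1 f2 h : measurable_fun setT f1 -> measurable_fun setT f2 ->
    measurable_fun setT h -> (forall y, 0 <= f1 y)%E -> (forall y, 0 <= f2 y)%E ->
    (forall y, 0 <= h y)%E -> ae_eq mu setT f1 f2 ->
    convolution f1 h =1 convolution f2 h.
  move=> mf mf' mg mg' f0 f'0 g0 g'0 ff' gg' u.
  by rewrite (H f f')// convolutionC// (H g g')// convolutionC.
move=> mf1 mf2 mh f10 f20 h0 f12 u; apply: ge0_ae_eq_integral => //.
- by apply: emeasurable_funM => //; exact: measurable_fun_subl.
- by apply: emeasurable_funM => //; exact: measurable_fun_subl.
- by move=> y _; exact: mule_ge0.
- by move=> y _; exact: mule_ge0.
- by apply: filterS f12 => y /= /[apply] ->.
Qed.

(** Pairing larger with larger gives the larger sum.  The usual proof expands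
    [(x - x') (y - y')]; with infinite values the difference [x - x'] is only
    available when [x'] is finite, and otherwise [x = x']. *)
Lemma rearrangement (x x' y y' : \bar R) :
  (0 <= x')%E -> (x' <= x)%E -> (0 <= y')%E -> (y' <= y)%E ->
  (x * y' + x' * y <= x * y + x' * y')%E.
Proof.
move=> x'0 xx' y'0 yy'.
have x0 := le_trans x'0 xx'; have y0 := le_trans y'0 yy'.
have [->//|xNx'] := eqVneq x x'; first by rewrite addeC.
have x'fin : x' \is a fin_num.
  rewrite ge0_fin_numE//; apply: lt_le_trans (leey x).
  by rewrite lt_neqAle xx' eq_sym xNx'.
rewrite -(subeK x x'fin).
have d0 : (0 <= x - x')%E by rewrite sube_ge0 ?x'fin ?orbT.
move: (x - x')%E d0 => z z0.
rewrite !ge0_muleDl// -!addeA (addeC (x' * y')%E).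
by apply: leeD2r; exact: lee_wpmul2l.
Qed.

(** In this form a comparison of absolute values becomes the sign of a product of
    two affine expressions, which is what a reflection acts on. *)
Lemma norm_le_sqr (x y : R) : (`|x| <= `|y|) = (0 <= (y - x) * (y + x)).
Proof. by rewrite -ler_sqr ?nnegrE// !real_normK ?num_real// -subr_ge0 subr_sqr. Qed.

(** Let [|u| <= |v|].  The reflection that exchanges [u] and [v] (after centring)
    writes twice the convolution at [u] as the integral of
    [f z g (u - z) + f z' g (v - z)], with [z' = u + v - z], and twice the
    convolution at [v] as the integral of [f z g (v - z) + f z' g (u - z)].
    Comparing [|z|] with [|z'|] and [|u - z|] with [|v - z|] amounts to the signs
    of [(u + v - 2 z) (u + v)] and of [(u + v - 2 z) (v - u)].  These are never
    opposite because [(u + v) (v - u)] is nonnegative, so [f] and [g] are larger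
    on the same side and [rearrangement] compares the integrands at every [z]. *)
Lemma peaked_convolution c c' f g :
  measurable_fun setT f -> measurable_fun setT g ->
  (forall y, 0 <= f y)%E -> (forall y, 0 <= g y)%E ->
  peaked c f -> peaked c' g -> peaked (c + c') (convolution f g).
Proof.
move=> mf mg f0 g0 fc gc' u v uv.
(* In terms of z = y - c, the map y -> b - y is z -> u + v - z. *)
pose b := c + c + (u + v).
have mfg x x' : measurable_fun setT (fun y => (f y * g (x - y)%R)%E).
  by apply: emeasurable_funM => //; exact: measurable_fun_subl.
have mfgb x x' : measurable_fun setT (fun y => (f (b - y)%R * g (x - (b - y))%R)%E).
  apply: emeasurable_funM; first exact: measurable_fun_subl.
  by apply: (measurable_fun_subl (fun z => g (x - z))); exact: measurable_fun_subl.
have double w : (2%:E * convolution f g w = \int[mu]_y (f y * g (w - y)%R +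
     f (b - y)%R * g (w - (b - y))%R))%E.
  rewrite ge0_integralD//.
  - by rewrite -convolutionE_reflect// -mule2n -mule_natl.
  - by move=> y _; exact: mule_ge0.
  - exact: mfg.
  - by move=> y _; exact: mule_ge0.
  - exact: mfgb.
rewrite -(@lee_pmul2l _ 2%:E)// !double.
apply: ge0_le_integral => //.
- by move=> y _; apply: adde_ge0; exact: mule_ge0.
- by apply: emeasurable_funD; [exact: mfg|exact: mfgb].
- by apply: emeasurable_funD; [exact: mfg|exact: mfgb].
move=> y _.
have E1 : f y = f (c + (y - c)) by congr f; ring.
have E2 : f (b - y) = f (c + (u + v - (y - c))) by congr f; rewrite /b; ring.
have E3 : g (c + c' + v - y) = g (c' + (v - (y - c))) by congr g; ring.
have E4 : g (c + c' + u - y) = g (c' + (u - (y - c))) by congr g; ring.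
have E5 : g (c + c' + v - (b - y)) = g (c' + ((y - c) - u)).
  by congr g; rewrite /b; ring.
have E6 : g (c + c' + u - (b - y)) = g (c' + ((y - c) - v)).
  by congr g; rewrite /b; ring.
have symg s : g (c' - s) = g (c' + s).
  by apply/eqP; rewrite eq_le !gc'// normrN.
rewrite E1 E2 E3 E4 E5 E6 -(opprB u) -(opprB v) !symg.
move: (y - c) => z {E1 E2 E3 E4 E5 E6}.
move: uv; rewrite norm_le_sqr => uv.
pose m := u + v - z - z.
have lef s t : 0 <= (t - s) * (t + s) -> (f (c + t)%R <= f (c + s)%R)%E.
  by rewrite -norm_le_sqr; exact: fc.
have leg s t : 0 <= (t - s) * (t + s) -> (g (c' + t)%R <= g (c' + s)%R)%E.
  by rewrite -norm_le_sqr; exact: gc'.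
have SD : 0 <= (m * (u + v)) * (m * (v - u)).
  rewrite mulrACA; apply: mulr_ge0; first exact: sqr_ge0.
  by rewrite mulrC (addrC u).
have near_u : 0 <= m * (u + v) -> 0 <= m * (v - u) ->
  (f (c + (u + v - z))%R <= f (c + z)%R)%E /\
  (g (c' + (v - z))%R <= g (c' + (u - z))%R)%E.
  move=> S0 D0; split; [apply: lef|apply: leg].
    by rewrite (_ : _ * _ = m * (u + v))// /m; ring.
  by rewrite (_ : _ * _ = m * (v - u))// /m; ring.
have near_v : m * (u + v) <= 0 -> m * (v - u) <= 0 ->
  (f (c + z)%R <= f (c + (u + v - z))%R)%E /\
  (g (c' + (u - z))%R <= g (c' + (v - z))%R)%E.
  move=> S0 D0; split; [apply: lef|apply: leg].
    by rewrite (_ : _ * _ = - (m * (u + v))) ?oppr_ge0// /m; ring.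
  by rewrite (_ : _ * _ = - (m * (v - u))) ?oppr_ge0// /m; ring.
have [[ff gg]|[ff gg]] :
  ((f (c + (u + v - z))%R <= f (c + z)%R)%E /\
   (g (c' + (v - z))%R <= g (c' + (u - z))%R)%E) \/
  ((f (c + z)%R <= f (c + (u + v - z))%R)%E /\
   (g (c' + (u - z))%R <= g (c' + (v - z))%R)%E).
- have [D0|D0] := ltP 0 (m * (v - u)).
    by left; apply: near_u (ltW D0); rewrite -(pmulr_lge0 _ D0).
  have [S0|S0] := ltP 0 (m * (u + v)).
    by left; apply: near_u (ltW S0) _; rewrite -(pmulr_rge0 _ S0).
  by right; exact: near_v.
- exact: rearrangement.
- by rewrite addeC [leRHS]addeC; exact: rearrangement.
Qed.

(** The integrand is nonzero only where the two supports meet.  They meet in at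
    most one point even when [|s| = n + n'], and one point has measure zero. *)
Lemma convolution_vanishes c c' n n' f g :
  vanishes_beyond c n f -> vanishes_beyond c' n' g ->
  forall s, n + n' <= `|s| -> convolution f g (c + c' + s) = 0%E.
Proof.
move=> fn gn s ns.
(* y0 is the end of the first support on the side of s. *)
have [y0 Hy0] : exists y0, forall y, y != y0 ->
    n < `|y - c| \/ n' < `|c + s - y|.
  have [s0|s0] := leP 0 s.
    exists (c + n) => y yn; move: ns; rewrite ger0_norm// => ns.
    have [yl|yl] := ltP (c + n) y; [left|right].
      by apply: lt_le_trans (ler_norm _); lra.
    apply: lt_le_trans (ler_norm _).
    by have : y < c + n; [rewrite lt_neqAle yn|lra].
  exists (c - n) => y yn; move: ns; rewrite ltr0_norm// => ns.
  have [yl|yl] := ltP y (c - n); [left|right].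
    by rewrite distrC; apply: lt_le_trans (ler_norm _); lra.
  rewrite distrC; apply: lt_le_trans (ler_norm _).
  by have : c - n < y; [rewrite lt_neqAle eq_sym yn|lra].
have fg0 y : y != y0 -> (f y * g (c + c' + s - y)%R = 0)%E.
  move=> /Hy0[/fn|/gn]; first by rewrite addrC subrK => ->; rewrite mul0e.
  by rewrite (_ : c' + _ = c + c' + s - y) => [->|]; [rewrite mule0|ring].
rewrite /convolution -(@integral_setD1 _ _ y0)//.
- by apply: integral0_eq => y [_ /eqP]; exact: fg0.
- exact: measurableD.
- apply: (eq_measurable_fun (cst 0%E)) => // y.
  by rewrite inE/= => -[_ /eqP /fg0 ->].
Qed.

End real_line.

(** * Densities *)

Section density.
Context {R : realType}.
Local Notation TR := (measurableTypeR R).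
Local Notation mu := (@lebesgue_measure R).
Implicit Types (f g phi : R -> \bar R).

Lemma ae_eq_density (f g : R -> \bar R) :
  measurable_fun setT f -> measurable_fun setT g ->
  (forall y, 0 <= f y)%E -> (\int[mu]_y f y < +oo)%E ->
  (forall B : set TR, measurable B ->
     \int[mu]_(y in B) f y = \int[mu]_(y in B) g y)%E ->
  ae_eq mu setT f g.
Proof.
move=> mf mg f0 foo fg; apply: integral_ae_eq => //.
- apply/integrableP; split => //.
  by under eq_integral do rewrite gee0_abs//.
- by move=> B _; exact: fg.
Qed.

(** This change of variables is known for the Radon-Nikodym derivative of [nu],
    and [f] equals that derivative almost everywhere. *)
Lemma integral_density (nu : {finite_measure set TR -> \bar R}) f phi :
  measurable_fun setT f -> (forall y, 0 <= f y)%E ->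
  (forall B : set TR, measurable B -> nu B = \int[mu]_(y in B) f y)%E ->
  measurable_fun setT phi -> (forall y, 0 <= phi y)%E ->
  (\int[nu]_y phi y = \int[mu]_y (f y * phi y))%E.
Proof.
move=> mf f0 nuf mphi phi0.
have numu : nu `<< mu.
  apply/null_content_dominatesP => B mB B0.
  by rewrite nuf//; apply: null_set_integral => //; exact/measurable_funTS.
pose f' := Radon_Nikodym_SigmaFinite.f nu mu.
have f'0 := Radon_Nikodym_SigmaFinite.f_ge0 numu.
have intf' := Radon_Nikodym_SigmaFinite.f_integrable numu.
rewrite -(Radon_Nikodym_SigmaFinite.change_of_variables numu)//.
apply: ge0_ae_eq_integral => //.
- by apply: emeasurable_funM => //; exact: measurable_int intf'.
- exact: emeasurable_funM.
- by move=> y _; apply: mule_ge0.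
- by move=> y _; apply: mule_ge0.
have : ae_eq mu setT f' f.
  apply: integral_ae_eq => // B _ mB.
  by rewrite -nuf// -Radon_Nikodym_SigmaFinite.f_integral.
by apply: filterS => y /= + yT => /(_ yT) <-; exact: muleC.
Qed.

Lemma integral_indicM (B : set TR) f :
  (\int[mu]_(y in B) f y = \int[mu]_y (f y * (\1_B y)%:E))%E.
Proof. by rewrite integral_mkcond epatch_indic. Qed.

End density.

(** * The law of a function of two independent variables *)

Section laws.
Context {d : measure_display} {Om : measurableType d} {R : realType}.
Variable P : probability Om R.
Local Notation TR := (measurableTypeR R).
Local Notation mu := (@lebesgue_measure R).

Definition independent2 (U V : Om -> R) := forall B C : set TR,
  measurable B -> measurable C ->
  P (U @^-1` B `&` V @^-1` C) = (P (U @^-1` B) * P (V @^-1` C))%E.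

Lemma ae_eq_pdf X f g : is_pdf P X f -> is_pdf P X g -> ae_eq mu setT f g.
Proof.
move=> [f0 mf fE] [g0 mg gE]; apply: ae_eq_density => //.
  by rewrite -fE// preimage_setT probability_setT ltry.
by move=> B mB; rewrite -fE// -gE.
Qed.

Lemma uniform_is_pdf (X : {RV P >-> R}) p q : uniform_on X p q ->
  is_pdf P X (fun y => (uniform_pdf p q y)%:E).
Proof.
move=> [pq XE]; split.
- by move=> y; rewrite lee_fin uniform_pdf_ge0.
- by apply/measurable_EFinP; exact: measurable_uniform_pdf.
- by move=> B mB; exact: XE.
Qed.

(** By independence the law of the pair is the product of the two laws, because a
    product measure is determined by its values on rectangles. *)
Lemma prob_independent2 (U V : Om -> R) f g (E : set (TR * TR)) :
  measurable_fun setT U -> measurable_fun setT V -> independent2 U V ->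
  is_pdf P U f -> is_pdf P V g -> measurable E ->
  (P ((fun w => (U w, V w)) @^-1` E) =
   \int[mu]_x (f x * \int[mu]_y (g y * (\1_E (x, y))%:E)))%E.
Proof.
move=> mU mV UV [f0 mf fE] [g0 mg gE] mE.
pose U1 : Om -> TR := U; pose V1 : Om -> TR := V.
have mU1 : measurable_fun setT U1 by exact: mU.
have mV1 : measurable_fun setT V1 by exact: mV.
pose W1 w := (U1 w, V1 w).
have mW1 : measurable_fun setT W1 by exact: measurable_fun_pair.
pose mixU := isMeasurableFun.Build _ _ _ _ _ mU1.
pose mixV := isMeasurableFun.Build _ _ _ _ _ mV1.
pose mixW := isMeasurableFun.Build _ _ _ _ _ mW1.
pose U2 : {mfun _ >-> _} := HB.pack U1 mixU.
pose V2 : {mfun _ >-> _} := HB.pack V1 mixV.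
pose W2 : {mfun _ >-> _} := HB.pack W1 mixW.
have := @product_measure_unique _ _ _ _ _ (distribution P U2) (distribution P V2)
  (distribution P W2) _ E mE.
move=> H.
transitivity ((distribution P U2 \x distribution P V2)%E E).
  by rewrite H// => A B mA mB; exact: UV.
rewrite /product_measure1 (@integral_density _ _ f)//.
- apply: eq_integral => x _; congr (_ * _)%E.
  rewrite /= [LHS](gE (xsection E x)); last exact: measurable_xsection.
  rewrite integral_indicM; apply: eq_integral => y _.
  by rewrite !indicE mem_xsection.
- exact: measurable_fun_xsection.
Qed.

(** For nonnegative arguments the inverse is the power of exponent [-1], whose
    measurability is known. *)
Lemma measurable_invr_ge0 (w : R -> R) : measurable_fun setT w ->
  (forall c, 0 <= w c) -> measurable_fun setT (fun c => (w c)^-1).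
Proof.
move=> mw w0; apply: (eq_measurable_fun (fun c => w c `^ (-1))) => [c _|].
  by rewrite powR_inv1.
have mp : measurable_fun setT (fun x : R => x `^ (-1)) by exact: measurable_powR.
exact: (measurableT_comp mp mw).
Qed.

(** Density of [m U + w U * V] for independent [U] and [V] of densities [f] and
    [g]: given [U = c], the variable [m c + w c * V] has density
    [(w c)^-1 g ((y - m c) / w c)] when [w c > 0]. *)
Definition mixture (f g : R -> \bar R) (m w : R -> R) (y : R) : \bar R :=
  (\int[mu]_c (f c * ((w c)^-1%:E * g ((y - m c) / w c)%R)))%E.

Section mixture.
Variables (f g : R -> \bar R) (m w : R -> R).
Hypotheses (mf : measurable_fun setT f) (mg : measurable_fun setT g)
  (mm : measurable_fun setT m) (mw : measurable_fun setT w).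
Hypotheses (f0 : forall y, (0 <= f y)%E) (g0 : forall y, (0 <= g y)%E)
  (w0 : forall c, 0 <= w c).

Lemma mixture_ge0 y : (0 <= mixture f g m w y)%E.
Proof.
by apply: integral_ge0 => c _; rewrite !mule_ge0// lee_fin invr_ge0.
Qed.

Lemma measurable_mixture_integrand : measurable_fun [set: TR * TR]
  (fun z => f z.2 * ((w z.2)^-1%:E * g ((z.1 - m z.2) / w z.2)%R))%E.
Proof.
have mV : measurable_fun [set: TR * TR] (fun z => (w z.2)^-1 : R).
  exact: (measurableT_comp (measurable_invr_ge0 w mw w0) measurable_snd).
have mA : measurable_fun [set: TR * TR] (fun z => (z.1 - m z.2) / w z.2 : R).
  apply: measurable_funM mV; apply: measurable_funB; first exact: measurable_fst.
  exact: (measurableT_comp mm measurable_snd).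
apply: emeasurable_funM; first exact: (measurableT_comp mf measurable_snd).
apply: emeasurable_funM; first exact/measurable_EFinP.
exact: (measurableT_comp mg mA).
Qed.

Lemma measurable_mixture : measurable_fun setT (mixture f g m w).
Proof.
apply: (@measurable_fun_fubini_tonelli_F _ _ _ _ _ mu
  (fun z : TR * TR => f z.2 * ((w z.2)^-1%:E * g ((z.1 - m z.2) / w z.2)%R))%E).
  exact: measurable_mixture_integrand.
by move=> z; rewrite !mule_ge0// lee_fin invr_ge0.
Qed.

(** For almost every [c] substitute [y = m c + w c * v] in the inner integral of
    [prob_independent2], then exchange the order of integration.  The zeros of
    [w] have to be negligible, since there the conditional law is a point
    mass. *)
Lemma mixture_pdf (U V : Om -> R) :
  measurable_fun setT U -> measurable_fun setT V -> independent2 U V ->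
  is_pdf P U f -> is_pdf P V g -> mu [set c | w c = 0] = 0%E ->
  is_pdf P (fun o => m (U o) + V o * w (U o)) (mixture f g m w).
Proof.
move=> mU mV UV Uf Vg w_neq0.
split; [exact: mixture_ge0|exact: measurable_mixture|move=> B mB].
pose E : set (TR * TR) := [set z | B (m z.1 + z.2 * w z.1)].
have mE : measurable E.
  have mh : measurable_fun [set: TR * TR] (fun z => m z.1 + z.2 * w z.1 : R).
    apply: measurable_funD; first exact: (measurableT_comp mm measurable_fst).
    apply: measurable_funM; first exact: measurable_snd.
    exact: (measurableT_comp mw measurable_fst).
  by rewrite -[E]setTI; exact: mh.
rewrite [LHS](prob_independent2 U V f g E)//.
have mB1 : measurable_fun setT (fun y : R => (\1_B y)%:E : \bar R).
  by apply/measurable_EFinP; exact: measurable_indic.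
pose F (z : TR * TR) :=
  (f z.2 * ((w z.2)^-1%:E * g ((z.1 - m z.2) / w z.2)%R) * (\1_B z.1)%:E)%E.
have mF : measurable_fun setT F.
  apply: emeasurable_funM; first exact: measurable_mixture_integrand.
  exact: (measurableT_comp mB1 measurable_fst).
have F0 z : (0 <= F z)%E.
  by rewrite !mule_ge0// lee_fin// invr_ge0.
rewrite [RHS]integral_indicM.
transitivity (\int[mu]_y \int[mu]_c F (y, c))%E; last first.
  apply: eq_integral => y _; rewrite /F/= ge0_integralZr//.
  - exact: (measurableT_comp measurable_mixture_integrand (pair1_measurable y)).
  - by move=> c _; rewrite !mule_ge0// lee_fin invr_ge0.
rewrite [RHS](@fubini_tonelli _ _ _ _ _ mu mu F)//.
have mgE : measurable_fun [set: TR * TR] (fun z => g z.2 * (\1_E z)%:E)%E.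
  apply: emeasurable_funM; first exact: (measurableT_comp mg measurable_snd).
  by apply/measurable_EFinP; exact: measurable_indic.
apply: ge0_ae_eq_integral => //.
- apply: emeasurable_funM => //.
  apply: (@measurable_fun_fubini_tonelli_F _ _ _ _ _ mu
    (fun z : TR * TR => g z.2 * (\1_E z)%:E)%E) => // z.
  by rewrite mule_ge0// lee_fin.
- exact: measurable_fun_fubini_tonelli_G.
- move=> c _; apply: mule_ge0 => //; apply: integral_ge0 => y _.
  by rewrite mule_ge0// lee_fin.
- by move=> c _; exact: integral_ge0.
exists [set c | w c = 0]; split => //.
- rewrite -[X in measurable X]setTI.
  exact: (mw measurableT [set 0] (measurable_set1 _)).
move=> c; apply: contra_notP => /eqP wc _.
have {}wc : 0 < w c by rewrite lt_neqAle eq_sym wc w0.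
have mgc : measurable_fun setT (fun y : R => g ((y - m c) / w c)).
  have mA : measurable_fun setT (fun y : R => (y - m c) / w c : R).
    by apply: measurable_funM => //; apply: measurable_funB.
  exact: measurableT_comp mg mA.
rewrite /fubini_G (ge0_integral_affine (w c)^-1 (- m c / w c)); last 3 first.
- by rewrite invr_eq0 gt_eqF.
- exact: (measurableT_comp mgE (pair1_measurable c)).
- by move=> y; rewrite mule_ge0// lee_fin.
rewrite ger0_norm ?invr_ge0//.
have Einv y : \1_E (c, (w c)^-1 * y + - m c / w c) = \1_B y :> R.
  rewrite !indicE; congr (nat_of_bool _)%:R; apply/idP/idP; rewrite !inE /E/=;
    by rewrite (_ : m c + _ = y)//; field; rewrite gt_eqF.
transitivity (f c * ((w c)^-1%:E * \int[mu]_y (g ((y - m c) / w c)%R * (\1_B y)%:E)))%E.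
  congr (_ * (_ * _))%E; apply: eq_integral => y _ /=.
  by rewrite Einv mulrC -mulrDl.
have gB0 y : (0 <= g ((y - m c) / w c)%R * (\1_B y)%:E)%E.
  by rewrite mule_ge0// lee_fin.
have mgB : measurable_fun setT (fun y : R => g ((y - m c) / w c)%R * (\1_B y)%:E)%E.
  exact: emeasurable_funM.
rewrite -[X in (_ * X)%E]ge0_integralZl//; last by rewrite lee_fin invr_ge0.
rewrite -ge0_integralZl//.
- by apply: eq_integral => y _; rewrite /F/= !muleA.
- by apply: emeasurable_funM.
- by move=> y _; rewrite mule_ge0// lee_fin invr_ge0.
Qed.

End mixture.

(** Convolution is the mixture of the translates of [g]. *)
Lemma convolution_pdf (U V : Om -> R) f g :
  measurable_fun setT U -> measurable_fun setT V -> independent2 U V ->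
  is_pdf P U f -> is_pdf P V g -> is_pdf P (fun o => U o + V o) (convolution f g).
Proof.
move=> mU mV UV Uf Vg; have [f0 mf _] := Uf; have [g0 mg _] := Vg.
have -> : (fun o => U o + V o) = (fun o => id (U o) + V o * cst 1 (U o)).
  by apply/funext => o; rewrite mulr1.
have -> : convolution f g = mixture f g id (cst 1).
  apply/funext => u; apply: eq_integral => y _ /=.
  by rewrite invr1 mulr1 mul1e.
apply: mixture_pdf => //.
rewrite (_ : [set _ | _] = set0) ?measure0//.
by apply/seteqP; split => // c /= /eqP; rewrite oner_eq0.
Qed.

Lemma scale_pdf (k : R) (S : Om -> R) f : 0 < k -> is_pdf P S f ->
  is_pdf P (fun o => k^-1 * S o) (fun u => k%:E * f (k * u)%R)%E.
Proof.
move=> k0 [f0 mf fE].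
have mk (k' : R) : measurable_fun [set: R] (fun x : R => k' * x).
  exact: measurable_funM.
have mfk : measurable_fun setT (fun u : R => f (k * u)).
  exact: (measurableT_comp mf (mk k)).
split.
- by move=> u; rewrite mule_ge0// lee_fin ltW.
- exact: emeasurable_funM.
move=> B mB.
have mB' : measurable ((fun x : R => k^-1 * x) @^-1` B).
  by rewrite -[X in measurable X]setTI; exact: (mk k^-1).
have mfB : measurable_fun setT
    (fun y : R => f y * (\1_((fun x : R => k^-1 * x) @^-1` B) y)%:E)%E.
  apply: emeasurable_funM => //; apply/measurable_EFinP; exact: measurable_indic.
rewrite -[LHS]/(P (S @^-1` ((fun x : R => k^-1 * x) @^-1` B))) fE//.
rewrite integral_indicM [RHS]integral_indicM (ge0_integral_affine k 0) ?gt_eqF//; last first.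
  by move=> y; rewrite mule_ge0// lee_fin.
rewrite gtr0_norm// -ge0_integralZl//; last 3 first.
- exact: (measurableT_comp mfB (measurable_affine k 0)).
- by move=> y _; rewrite mule_ge0// lee_fin.
- by rewrite lee_fin ltW.
apply: eq_integral => y _; rewrite addr0 muleA; congr (_ * (_)%:E)%E.
by rewrite !indicE; congr (nat_of_bool _)%:R; apply/idP/idP;
  rewrite !inE/= mulKf// gt_eqF.
Qed.

End laws.

(** * Independence of functions of disjoint pairs *)

Section independence.
Context {d : measure_display} {Om : measurableType d} {R : realType}.
Variable P : probability Om R.
Local Notation TR := (measurableTypeR R).

(** Both sides are finite measures in [E], and they agree on the rectangles, which
    are stable under intersection and generate the product sigma-algebra. *)
Lemma prob_pair_event (U V : Om -> R) (F : set Om) :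
  measurable_fun setT U -> measurable_fun setT V -> measurable F ->
  (forall B C : set TR, measurable B -> measurable C ->
    P (U @^-1` B `&` V @^-1` C `&` F) = P (U @^-1` B `&` V @^-1` C) * P F)%E ->
  forall E : set (TR * TR), measurable E ->
    (P ((fun o => (U o, V o)) @^-1` E `&` F) =
     P ((fun o => (U o, V o)) @^-1` E) * P F)%E.
Proof.
move=> mU mV mF H E mE.
pose U1 : Om -> TR := U; pose V1 : Om -> TR := V.
have mU1 : measurable_fun setT U1 by exact: mU.
have mV1 : measurable_fun setT V1 by exact: mV.
pose W1 w := (U1 w, V1 w).
have mW1 : measurable_fun setT W1 by exact: measurable_fun_pair.
pose mixW := isMeasurableFun.Build _ _ _ _ _ mW1.
pose W2 : {mfun _ >-> _} := HB.pack W1 mixW.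
have PF : P F \is a fin_num by exact: fin_num_measure.
pose k := NngNum (fine_ge0 (measure_ge0 P F)).
rewrite -[P F]fineK// muleC.
pose G : set (set (TR * TR)) :=
  [set X | exists2 B, measurable B & exists2 C, measurable C & B `*` C = X].
apply: (measure_unique G (fun=> setT) _ _ _ _
  (pushforward (mrestr P mF) W2) (mscale k (pushforward P W2)) _ _ _ mE).
- by rewrite measurable_prod_measurableType.
- move=> _ _ [B1 mB1 [C1 mC1 <-]] [B2 mB2 [C2 mC2 <-]].
  rewrite -setXI; exists (B1 `&` B2); first exact: measurableI.
  by exists (C1 `&` C2); first exact: measurableI.
- by move=> _; exists setT => //; exists setT => //; rewrite setXTT.
- by rewrite bigcup_const//; exists 0%N.
- move=> _ [B mB [C mC <-]].
  rewrite /= /mscale/= /pushforward /mrestr/= -[P F]fineK// muleC in H *.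
  exact: H.
- move=> _; rewrite /pushforward/= /mrestr/=.
  rewrite [ltLHS](_ : _ = P F); first by rewrite ltey_eq PF.
  by congr (P _); apply/seteqP; split => o //= [].
Qed.

Lemma bigcap_isolate {T : Type} {I : eqType} (X : I -> set T) (j : I) :
  \bigcap_k X k = X j `&` \bigcap_(k in [set k | k != j]) X k.
Proof.
apply/seteqP; split=> [w Xw|w [Xj Xw] k _]; first by split=> [|k _]; exact: Xw.
by have [->//|kj] := eqVneq k j; exact: Xw.
Qed.

(** Product events are replaced by arbitrary measurable events of the plane one
    index at a time, with [prob_pair_event] applied to the event [F] that
    concerns the other indices. *)
Lemma pairs_independent {I : finType} (A C : I -> Om -> R) :
  (forall k, measurable_fun setT (A k)) ->
  (forall k, measurable_fun setT (C k)) ->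
  (forall B B' : I -> set TR,
    (forall k, measurable (B k)) -> (forall k, measurable (B' k)) ->
    P (\bigcap_k (A k @^-1` B k `&` C k @^-1` B' k)) =
    \prod_k P (A k @^-1` B k `&` C k @^-1` B' k))%E ->
  forall D : I -> set (TR * TR), (forall k, measurable (D k)) ->
    (P (\bigcap_k ((fun o => (A k o, C k o)) @^-1` D k)) =
     \prod_k P ((fun o => (A k o, C k o)) @^-1` D k))%E.
Proof.
move=> mA mC rectE D mD.
pose AC k o : TR * TR := (A k o, C k o).
have mAC k (E : set (TR * TR)) : measurable E -> measurable (AC k @^-1` E).
  move=> mE; rewrite -[X in measurable X]setTI.
  have mACk : measurable_fun setT (AC k).
    by apply: measurable_fun_pair; [exact: mA|exact: mC].
  exact: mACk.
pose rectangle (E : set (TR * TR)) := exists BB : set TR * set TR,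
  [/\ measurable BB.1, measurable BB.2 & E = BB.1 `*` BB.2].
(* s lists the indices whose event is already arbitrary. *)
suff H (s : seq I) : forall D : I -> set (TR * TR), (forall k, measurable (D k)) ->
    (forall k, k \notin s -> rectangle (D k)) ->
    P (\bigcap_k (AC k @^-1` D k)) = (\prod_k P (AC k @^-1` D k))%E.
  by apply: (H (enum I)) => // k; rewrite mem_enum.
elim: s {D mD} => [|j s IH] D mD rD.
  have /choice[BB BBP] : forall k, exists BB : set TR * set TR,
    [/\ measurable BB.1, measurable BB.2 & D k = BB.1 `*` BB.2].
    by move=> k; exact: rD.
  have E k : AC k @^-1` D k = A k @^-1` (BB k).1 `&` C k @^-1` (BB k).2.
    by have [_ _ ->] := BBP k.
  under eq_bigcapr do rewrite E.
  under eq_bigr do rewrite E.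
  by apply: rectE => k; have [] := BBP k.
pose F := \bigcap_(k in [set k | k != j]) (AC k @^-1` D k).
have mF : measurable F.
  apply: fin_bigcap_measurable; first exact: finite_finset.
  by move=> k _; exact: mAC.
pose Q := (\prod_(k | k != j) P (AC k @^-1` D k))%E.
have rectF E : measurable E -> rectangle E ->
    P (AC j @^-1` E `&` F) = (P (AC j @^-1` E) * Q)%E.
  move=> mE rE.
  have := IH (fun k => if k == j then E else D k).
  rewrite (bigcap_isolate _ j) (bigD1 j)//= eqxx.
  have -> : \bigcap_(k in [set k | k != j]) (AC k @^-1` (if k == j then E else D k)) = F.
    by apply: eq_bigcapr => k /= /negbTE ->.
  rewrite (eq_bigr (fun k => P (AC k @^-1` D k))) => [|k /negbTE ->//].
  apply=> k; first by case: ifP.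
  by case: eqVneq => // kj ks; apply: rD; rewrite inE negb_or kj.
(* The probability of F is read off by taking the full plane for index j. *)
have rectT : rectangle setT by exists (setT, setT); rewrite /= setXTT.
have PF : P F = Q.
  by have := rectF setT measurableT rectT; rewrite preimage_setT setTI probability_setT mul1e.
rewrite (bigcap_isolate _ j) (bigD1 j)//= -/F -/Q -PF.
apply: prob_pair_event => // B B' mB mB'.
rewrite PF -(rectF (B `*` B'))//; first exact: measurableX.
by exists (B, B').
Qed.

Lemma mutually_independent2 {I : finType} (X : I -> {RV P >-> R}) (i j : I) :
  mutually_independent X -> i != j -> independent2 P (X i) (X j).
Proof.
move=> indX ij B C mB mC.
pose BC k := if k == i then B else C.
have mBC k : measurable (BC k) by rewrite /BC; case: ifP.
have BCi : BC i = B by rewrite /BC eqxx.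
have BCj : BC j = C by rewrite /BC eq_sym (negbTE ij).
have := indX [set i; j]%SET BC mBC.
rewrite big_setU1/= ?inE// big_set1/= BCi BCj => <-; congr (P _).
apply/seteqP; split=> [w [Xi Xj] k /=|w H].
  by rewrite !inE => /orP[/eqP ->|/eqP ->]; rewrite ?BCi ?BCj.
by split; [rewrite -BCi; apply: (H i)|rewrite -BCj; apply: (H j)];
  rewrite /= !inE eqxx ?orbT.
Qed.

Lemma rectangles_independent {I : finType} (A C : I -> {RV P >-> R}) :
  mutually_independent (fun i : I + I => match i with inl k => A k | inr k => C k end) ->
  forall B B' : I -> set TR,
    (forall k, measurable (B k)) -> (forall k, measurable (B' k)) ->
    (P (\bigcap_k (A k @^-1` B k `&` C k @^-1` B' k)) =
     \prod_k P (A k @^-1` B k `&` C k @^-1` B' k))%E.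
Proof.
move=> AC B B' mB mB'.
pose BB (i : I + I) := match i with inl k => B k | inr k => B' k end.
have mBB i : measurable (BB i) by case: i.
have AkCk k : P (A k @^-1` B k `&` C k @^-1` B' k) =
    (P (A k @^-1` B k) * P (C k @^-1` B' k))%E.
  exact: (mutually_independent2 _ (inl k) (inr k) AC isT).
under eq_bigr do rewrite AkCk.
rewrite big_split/=.
have := AC [set: I + I]%SET BB mBB.
rewrite [X in _ = X -> _](eq_bigl predT); last by move=> i; rewrite inE.
rewrite big_sumType/= => <-; congr (P _).
apply/seteqP; split=> [w H [k|k] _ /=|w H k _].
- by have [] := H k Logic.I.
- by have [] := H k Logic.I.
- by split; [apply: (H (inl k))|apply: (H (inr k))]; rewrite /= inE.
Qed.

(** The product rule over the whole family contains that over each subfamily: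
    take [setT] for the missing indices. *)
Definition independent (I : finType) (Y : I -> Om -> R) :=
  forall B : I -> set TR, (forall k, measurable (B k)) ->
  P (\bigcap_k (Y k @^-1` B k)) = (\prod_k P (Y k @^-1` B k))%E.

Lemma independent_three {I : finType} (Y : I -> Om -> R) (i j l : I)
    (B C D : set TR) : independent I Y -> uniq [:: i; j; l] ->
  measurable B -> measurable C -> measurable D ->
  (P (Y i @^-1` B `&` Y j @^-1` C `&` Y l @^-1` D) =
   P (Y i @^-1` B) * P (Y j @^-1` C) * P (Y l @^-1` D))%E.
Proof.
move=> indY /= /and3P[]; rewrite !inE negb_or => /andP[ij il] jl _ mB mC mD.
pose E k := if k == i then B else if k == j then C else if k == l then D else setT.
have mE k : measurable (E k) by rewrite /E; do ! case: ifP => // _.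
have Ei : E i = B by rewrite /E eqxx.
have Ej : E j = C by rewrite /E eq_sym (negbTE ij) eqxx.
have El : E l = D by rewrite /E eq_sym (negbTE il) eq_sym (negbTE jl) eqxx.
have := indY E mE.
rewrite (bigD1 i)//= (bigD1 j)/=; last by rewrite eq_sym.
rewrite (bigD1 l)/=; last by rewrite eq_sym il eq_sym.
rewrite Ei Ej El big1 ?mule1 => [|k /andP[/andP[ki kj] kl]]; last first.
  by rewrite /E (negbTE ki) (negbTE kj) (negbTE kl) preimage_setT probability_setT.
rewrite muleA => <-; congr (P _).
apply/seteqP; split => [w [[Bi Cj] Dl] k _|w H].
  rewrite /E/=; case: eqVneq => [->//|_]; case: eqVneq => [->//|_].
  by case: eqVneq => [->//|_].
split; first split.
- by rewrite -Ei; exact: H.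
- by rewrite -Ej; exact: H.
- by rewrite -El; exact: H.
Qed.

Lemma independent_two {I : finType} (Y : I -> Om -> R) (i j : I) :
  independent I Y -> i != j -> independent2 P (Y i) (Y j).
Proof.
move=> indY ij B C mB mC.
pose E k := if k == i then B else if k == j then C else setT.
have mE k : measurable (E k) by rewrite /E; do ! case: ifP => // _.
have Ei : E i = B by rewrite /E eqxx.
have Ej : E j = C by rewrite /E eq_sym (negbTE ij) eqxx.
have := indY E mE.
rewrite (bigD1 i)//= (bigD1 j)/=; last by rewrite eq_sym.
rewrite Ei Ej big1 ?mule1 => [<-|k /andP[ki kj]]; last first.
  by rewrite /E (negbTE ki) (negbTE kj) preimage_setT probability_setT.
congr (P _); apply/seteqP; split => [w [Bi Cj] k _|w H].
  by rewrite /E/=; case: eqVneq => [->//|_]; case: eqVneq => [->//|_].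
by split; [rewrite -Ei|rewrite -Ej]; exact: H.
Qed.

(** [independent_three] provides the hypothesis of [prob_pair_event]; an event on
    the sum is an event on the pair [(Y i, Y j)]. *)
Lemma independent_sum {I : finType} (Y : I -> Om -> R) (i j l : I) :
  (forall k, measurable_fun setT (Y k)) ->
  independent I Y -> uniq [:: i; j; l] ->
  independent2 P (fun w => Y i w + Y j w) (Y l).
Proof.
move=> mY indY ijl B C mB mC.
have mC' : measurable (Y l @^-1` C).
  by rewrite -[X in measurable X]setTI; exact: mY.
pose E : set (TR * TR) := [set z | B (z.1 + z.2)].
have mE : measurable E.
  have mD : measurable_fun [set: TR * TR] (fun z => z.1 + z.2 : R).
    by apply: measurable_funD; [exact: measurable_fst|exact: measurable_snd].
  by rewrite -[E]setTI; exact: mD.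
have := prob_pair_event (Y i) (Y j) (Y l @^-1` C) (mY i) (mY j) mC' _ E mE.
apply=> B1 B2 mB1 mB2.
have ij : i != j by move: ijl; rewrite /= !inE negb_or => /andP[/andP[]].
by rewrite (independent_three Y i j l)// (independent_two Y i j indY ij).
Qed.

Lemma independent_comp {I : finType} (A C : I -> {RV P >-> R})
    (phi : I -> TR * TR -> R) :
  mutually_independent (fun i : I + I => match i with inl k => A k | inr k => C k end) ->
  (forall k, measurable_fun setT (phi k)) ->
  independent I (fun k w => phi k (A k w, C k w)).
Proof.
move=> AC mphi B mB.
apply: (pairs_independent (fun k => A k : Om -> R) (fun k => C k : Om -> R)
  _ _ _ (fun k => phi k @^-1` B k)).
- by [].
- by [].
- exact: rectangles_independent.
- by move=> k; rewrite -[X in measurable X]setTI; exact: (mphi k measurableT _ (mB k)).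
Qed.

End independence.

(** * The shape of mixtures of centred densities *)

Section shape.
Context {R : realType}.
Local Notation TR := (measurableTypeR R).
Local Notation mu := (@lebesgue_measure R).

Lemma uniform_pdf_symE (a s : R) :
  uniform_pdf (- a) a s = if `|s| <= a then (a - - a)^-1 else 0.
Proof. by rewrite /uniform_pdf ler_norml. Qed.

Lemma peaked_uniform_pdf (a : R) : 0 < a ->
  peaked 0 (fun y => (uniform_pdf (- a) a y)%:E).
Proof.
move=> a0 s t st; rewrite !add0r lee_fin !uniform_pdf_symE.
case: ifPn => [ta|_]; first by rewrite (le_trans st ta).
by case: ifP => // _; rewrite invr_ge0 opprK addr_ge0// ltW.
Qed.

Lemma uniform_pdf_vanishes (a : R) :
  vanishes_beyond 0 a (fun y => (uniform_pdf (- a) a y)%:E).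
Proof.
by move=> s sa; rewrite add0r uniform_pdf_symE leNgt sa.
Qed.

(** With a constant centre the integrand is peaked at [p] for each fixed [c], and
    the inequality is integrated over [c]. *)
Lemma peaked_mixture (f g : R -> \bar R) (p : R) (w : R -> R) :
  measurable_fun setT f -> measurable_fun setT g -> measurable_fun setT w ->
  (forall y, 0 <= f y)%E -> (forall y, 0 <= g y)%E -> (forall c, 0 <= w c) ->
  peaked 0 g -> peaked p (mixture f g (cst p) w).
Proof.
move=> mf mg mw f0 g0 w0 g_peaked s t st.
have mI y : measurable_fun setT
    (fun c : TR => f c * ((w c)^-1%:E * g ((y - cst p c) / w c)%R))%E.
  exact: (measurableT_comp
    (measurable_mixture_integrand f g (cst p) w mf mg _ mw w0) (pair1_measurable y)).
apply: ge0_le_integral => //.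
- by move=> c _; rewrite !mule_ge0// lee_fin invr_ge0.
move=> c _; rewrite !lee_wpmul2l// ?lee_fin ?invr_ge0//=.
rewrite !(addrC p) !addrK -[t / _]add0r -[s / _]add0r; apply: g_peaked.
by rewrite !normrM ler_wpM2r.
Qed.

(** For each [c] of positive weight the rescaled [g] lives within distance
    [w c * a] of [p]. *)
Lemma mixture_vanishes (f g : R -> \bar R) (p a n : R) (w : R -> R) :
  (forall c, 0 <= w c) -> vanishes_beyond 0 a g ->
  (forall c, f c != 0%E -> w c * a <= n) ->
  vanishes_beyond p n (mixture f g (cst p) w).
Proof.
move=> w0 ga wn s ns; apply: integral0_eq => c _ /=.
have [->|/wn wan] := eqVneq (f c) 0%E; first by rewrite mul0e.
(* Here 0^-1 = 0 makes the integrand vanish. *)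
have [->|wc] := eqVneq (w c) 0; first by rewrite invr0 mul0e mule0.
have {}wc : 0 < w c by rewrite lt_neqAle eq_sym wc w0.
rewrite (addrC p) addrK -[s / _]add0r ga ?mule0//.
by rewrite normrM normfV (gtr0_norm wc) ltr_pdivlMr// mulrC (le_lt_trans wan).
Qed.

Lemma lebesgue_affine_zeros (p x : R) : (p != 0) || (x != 0) ->
  mu [set c | `|c * p - x| = 0] = 0%E.
Proof.
move=> px.
have [p0|p0] := eqVneq p 0.
  rewrite (_ : [set _ | _] = set0) ?measure0//.
  apply/seteqP; split=> // c /=; move: px; rewrite p0 eqxx mulr0 sub0r normrN /=.
  by move=> x0 /eqP; rewrite normr_eq0 (negbTE x0).
rewrite (_ : [set _ | _] = [set x / p]) ?lebesgue_measure_set1//.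
apply/seteqP; split=> [c /= /normr0_eq0/eqP|c ->]/=.
  by rewrite subr_eq0 => /eqP <-; rewrite mulfK.
by rewrite divfK// subrr normr0.
Qed.

End shape.

(** * The density of one term of the update *)

Lemma measurable_encircling_distance {R : realType} (p x : R) :
  measurable_fun [set: R] (fun c : R => `|c * p - x|).
Proof.
have : measurable_fun [set: R] (fun c : R => c * p - x).
  by apply: measurable_funB => //; exact: measurable_funM.
exact: measurableT_comp.
Qed.

Section encircling.
Context {R : realType}.
Variables (a p x : R).
Hypothesis a_gt0 : 0 < a.
Local Notation u02 := (fun c : R => (uniform_pdf 0 2 c)%:E).
Local Notation usym := (fun y : R => (uniform_pdf (- a) a y)%:E).

(** Given [C = c], the variable [p + A |C p - x|] is uniform on the interval of
    centre [p] and half-length [a |c p - x|]. *)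
Definition encircling_density : R -> \bar R :=
  mixture u02 usym (cst p) (fun c => `|c * p - x|).

Let u02_ge0 c : (0 <= u02 c)%E. Proof. by rewrite lee_fin uniform_pdf_ge0. Qed.

Let usym_ge0 y : (0 <= usym y)%E.
Proof. by rewrite lee_fin uniform_pdf_ge0// gtrN. Qed.

Let measurable_u02 : measurable_fun setT u02.
Proof. by apply/measurable_EFinP; exact: measurable_uniform_pdf. Qed.

Let measurable_usym : measurable_fun setT usym.
Proof. by apply/measurable_EFinP; exact: measurable_uniform_pdf. Qed.

(** The scaling factor [|c p - x|] vanishes for at most one [c]: were [p] and [x]
    both zero, the radius in the last hypothesis would be zero. *)
Lemma encircling_is_pdf {d : measure_display} {Om : measurableType d}
    (P : probability Om R) (A C : {RV P >-> R}) :
  uniform_on A (- a) a -> uniform_on C 0 2 -> independent2 P C A ->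
  0 < a * (`|p| + `|x - p|) ->
  is_pdf P (fun w => p + A w * `|C w * p - x|) encircling_density.
Proof.
move=> /uniform_is_pdf A_pdf /uniform_is_pdf C_pdf CA n_gt0.
apply: (@mixture_pdf _ _ _ P u02 usym (cst p) (fun c => `|c * p - x|)) => //.
  exact: measurable_encircling_distance.
apply: lebesgue_affine_zeros; rewrite -negb_and.
by apply/negP => /andP[/eqP p0 /eqP x0]; move: n_gt0;
  rewrite p0 x0 subrr normr0 addr0 mulr0 ltxx.
Qed.

Lemma peaked_encircling : peaked p encircling_density.
Proof.
apply: peaked_mixture => //; first exact: measurable_encircling_distance.
exact: peaked_uniform_pdf.
Qed.

Lemma encircling_vanishes :
  vanishes_beyond p (a * (`|p| + `|x - p|)) encircling_density.
Proof.
apply: (mixture_vanishes _ _ p a) => //; first exact: uniform_pdf_vanishes.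
move=> c; rewrite /uniform_pdf; case: ifPn => [/andP[c0 c2] _|]; last by rewrite eqxx.
rewrite mulrC ler_pM2l//.
(* For c in [0, 2] the coefficient c - 1 is at most 1 in absolute value. *)
rewrite (_ : c * p - x = (c - 1) * p - (x - p)); last by ring.
rewrite (le_trans (ler_normB _ _))// lerD2r normrM ler_piMl//.
by rewrite ler_norml; apply/andP; split; lra.
Qed.

End encircling.

Theorem corollary2p2 (R : realType) (d : measure_display)
    (Om : measurableType d) (P : probability Om R)
    (t T : nat) (t_ge1 : (1 <= t)%N) (t_ltT : (t < T)%N)
    (a : R) (aE : a = 2 * (1 - t%:R / T%:R))
    (p : 'I_3 -> R) (x : R)
    (A C : 'I_3 -> {RV P >-> R})
    (A_unif : forall k, uniform_on (A k) (- a) a)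
    (C_unif : forall k, uniform_on (C k) 0 2)
    (AC_indep : mutually_independent
       (fun i : 'I_3 + 'I_3 => match i with inl k => A k | inr k => C k end))
    (n : 'I_3 -> R) (nE : forall k, n k = a * (`|p k| + `|x - p k|))
    (n_gt0 : forall k, 0 < n k)
    (g : 'I_3 -> R -> \bar R)
    (g_pdf : forall k,
       is_pdf P (fun w => p k + A k w * `|C k w * p k - x|) (g k))
    (h : R -> \bar R)
    (hE : forall u, h u =
       (3%:E * convolution (convolution (g (inord 0)) (g (inord 1)))
                           (g (inord 2)) (3 * u)%R)%E) :
  let c := 3^-1 * \sum_(k < 3) p k in
  let r := 3^-1 * \sum_(k < 3) n k in
  [/\ is_pdf P (fun w => 3^-1 * (\sum_(k < 3) p k)
        + 3^-1 * \sum_(k < 3) A k w * `|C k w * p k - x|) h,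
      (forall s : R, h (c + s) = h (c - s)),
      h (c - r) = 0%E
    & {in `]c - r, c[ &, forall u v, u <= v -> (h u <= h v)%E}].
Proof.
move=> c r.
set i0 := inord 0 : 'I_3 in hE; set i1 := inord 1 : 'I_3 in hE.
set i2 := inord 2 : 'I_3 in hE.
have sum3 (F : 'I_3 -> R) : \sum_(k < 3) F k = F i0 + F i1 + F i2.
  rewrite !big_ord_recl big_ord0 addr0 addrA.
  by congr (F _ + F _ + F _); apply/val_inj; rewrite /= inordK.
have uniq3 : uniq [:: i0; i1; i2] by rewrite /= !inE -!val_eqE/= !inordK.
have i01 : i0 != i1 by rewrite -val_eqE/= !inordK.
pose Y k w := p k + A k w * `|C k w * p k - x|.
pose G := convolution (convolution (g i0) (g i1)) (g i2).
have h_def : h = (fun u => 3%:E * G (3 * u)%R)%E by apply/funext => u; exact: hE.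
pose phi k (z : measurableTypeR R * measurableTypeR R) : R :=
  p k + z.1 * `|z.2 * p k - x|.
have mphi k : measurable_fun setT (phi k).
  apply: measurable_funD => //; apply: measurable_funM; first exact: measurable_fst.
  exact: (measurableT_comp (measurable_encircling_distance (p k) x) measurable_snd).
have indepY : independent P 'I_3 Y by exact: (independent_comp P A C phi).
have mY k : measurable_fun setT (Y k).
  have mAC : measurable_fun setT
      (fun w => (A k w, C k w) : measurableTypeR R * measurableTypeR R).
    have mA : measurable_fun setT (A k : Om -> R) by [].
    have mC : measurable_fun setT (C k : Om -> R) by [].
    by apply: measurable_fun_pair; [exact: mA|exact: mC].
  exact: (measurableT_comp (mphi k) mAC).
have CA k : independent2 P (C k) (A k).
  exact: (mutually_independent2 _ _ (inr k) (inl k) AC_indep).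
have a_gt0 : 0 < a by case: (A_unif i0) => aa _; lra.
pose f k := encircling_density a (p k) x.
have f_pdf k : is_pdf P (Y k) (f k) by apply: encircling_is_pdf => //; rewrite -nE.
have f_peaked k : peaked (p k) (f k) by exact: peaked_encircling.
have f_van k : vanishes_beyond (p k) (n k) (f k).
  by rewrite nE; exact: encircling_vanishes.
have f0 k y : (0 <= f k y)%E by have [] := f_pdf k.
have mf k : measurable_fun setT (f k) by have [] := f_pdf k.
have g0 k y : (0 <= g k y)%E by have [] := g_pdf k.
have mg k : measurable_fun setT (g k) by have [] := g_pdf k.
have fg k : ae_eq lebesgue_measure setT (g k) (f k).
  exact: ae_eq_pdf (g_pdf k) (f_pdf k).
have G_def : G = convolution (convolution (f i0) (f i1)) (f i2).
  have -> : convolution (f i0) (f i1) = convolution (g i0) (g i1).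
    by apply/funext => u; apply/esym; exact: eq_convolution.
  apply/funext => u; apply: eq_convolution => //.
  - by apply: measurable_convolution.
  - by apply: measurable_convolution.
  - by move=> y; apply: convolution_ge0.
  - by move=> y; apply: convolution_ge0.
  - by apply: filterS (fg i2).
have G_pdf : is_pdf P (fun w => Y i0 w + Y i1 w + Y i2 w) G.
  have Y01 := convolution_pdf P _ _ _ _ (mY i0) (mY i1)
    (independent_two P Y i0 i1 indepY i01) (g_pdf i0) (g_pdf i1).
  apply: (convolution_pdf P _ _ _ _ _ (mY i2) _ Y01 (g_pdf i2)).
    exact: measurable_funD.
  exact: (independent_sum P Y i0 i1 i2 mY indepY uniq3).
pose f01 := convolution (f i0) (f i1).
have f01_0 y : (0 <= f01 y)%E by exact: convolution_ge0.
have mf01 : measurable_fun setT f01 by exact: measurable_convolution.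
have G_peaked : peaked (p i0 + p i1 + p i2) G.
  rewrite G_def.
  have f01_peaked : peaked (p i0 + p i1) f01 by exact: peaked_convolution.
  exact: (peaked_convolution _ _ _ _ mf01 (mf i2) f01_0 (f0 i2) f01_peaked).
(* The inner convolution vanishes strictly beyond n i0 + n i1, which is what the
   outer one needs to vanish also at the end point. *)
have G_van s : n i0 + n i1 + n i2 <= `|s| -> G (p i0 + p i1 + p i2 + s) = 0%E.
  rewrite G_def; apply: convolution_vanishes; last exact: f_van.
  by move=> z nz; apply: convolution_vanishes (ltW nz); exact: f_van.
have h_at s : h (c + s) = (3%:E * G (p i0 + p i1 + p i2 + 3 * s)%R)%E.
  by rewrite h_def /c sum3; congr (_ * G _)%E; field.
have h_peaked : peaked c h.
  move=> s t' st; rewrite !h_at lee_pmul2l//; apply: G_peaked.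
  by rewrite !normrM ler_wpM2l.
split.
- rewrite h_def.
  have -> : (fun w => 3^-1 * \sum_(k < 3) p k +
      3^-1 * \sum_(k < 3) A k w * `|C k w * p k - x|) =
    (fun w => 3^-1 * (Y i0 w + Y i1 w + Y i2 w)).
    by apply/funext => w; rewrite !sum3 /Y; ring.
  exact: scale_pdf.
- by move=> s; apply/eqP; rewrite eq_le !h_peaked// normrN.
- rewrite h_at G_van ?mule0//.
  rewrite /r sum3 mulrN normrN mulrA divff// mul1r.
  exact: ler_norm.
- move=> u v; rewrite !in_itv/= => /andP[_ uc] /andP[_ vc] uv.
  rewrite -(subrK c u) -(subrK c v) !(addrC _ c); apply: h_peaked.
  by rewrite !ltr0_norm ?subr_lt0//; lra.
Qed.
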